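(* Let $P$ be the transition matrix of a finite irreducible Markov chain with $m$ states, and let $P_0 = ee^T/m$ and, for $i=1,2,\dots,m$, $P_i = P_{i-1}+e_ib_i^T$, where $p_i^T = e_i^TP$ and $b_i^T = p_i^T-e^T/m$ (so $P_m=P$). Assume that each $P_i$ is irreducible. Then each of the following three variants (4A), (4B), (4C) of one procedure computes the stationary probability vector $\pi^T$ of the chain, the group inverse $A^{\#}$ of $A=I-P$, and the mean first passage time matrix $M$ of the chain. (i) Start with $K_0$, where: in (4A), $K_0 = I$; in (4B), $K_0 = I + e\left(\dfrac{e^T}{m}-e_1^T\right)$; in (4C), $K_0 = I - \left(\dfrac{m-1}{m^2}\right)ee^T$. (ii) For $i=1,2,\dots,m$, let $p_i^T = e_i^TP$, $b_i^T = p_i^T-e^T/m$, and $$K_i = K_{i-1}(I+C_i),\qquad\text{where}\quad k_i = 1-b_i^TK_{i-1}e_i,\qquad C_i = \frac{1}{k_i}e_ib_i^TK_{i-1}.$$ (iii) At $i=m$, let $K=K_m$ and compute $\pi^T$: in (4A), $\pi^T = \frac1m e^TK$; in (4B), $\pi^T = e_1^TK$; in (4C), $\pi^T = e^TK$. (iv) Compute $A^{\#} = (I-e\pi^T)K$. (v) Compute $M = [I-K+EK_d]D$, where $E$ is the $m\times m$ matrix with all entries equal to 1, $\Pi = e\pi^T$ and $D = (\Pi_d)^{-1}$.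
   Context: All matrices are real $m\times m$; $e$ is the column vector of all ones in $\mathbb{R}^m$ and $e_i$ is the $i$-th standard basis column vector. For a square matrix $X$, $X_d$ denotes the diagonal matrix having the same diagonal entries as $X$. A transition matrix is a stochastic matrix (nonnegative entries, each row sum 1). The matrix $P_i$ has its first $i$ rows equal to those of $P$ and its remaining rows equal to $e^T/m$. The stationary probability vector of an irreducible $P$ is the unique row vector $\pi^T$ with $\pi^T(I-P)=0^T$, $\pi^Te=1$ (all its entries are positive). The group inverse $A^{\#}$ of $A=I-P$ is the unique matrix with $AA^{\#}A=A$, $A^{\#}AA^{\#}=A^{\#}$, $AA^{\#}=A^{\#}A$. The mean first passage time matrix is $M=[m_{ij}]$, where $m_{ij}$ is the expected value, given $X_0=i$, of $\min\{n\ge 1: X_n=j\}$ for the Markov chain $(X_n)_{n\ge 0}$ with transition matrix $P$. *)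

(* Defs.v *)
From mathcomp Require Import all_boot all_order all_algebra.
From mathcomp Require Import all_classical all_reals all_analysis.

Set Implicit Arguments.
Unset Strict Implicit.
Unset Printing Implicit Defensive.

Import Order.TTheory GRing.Theory Num.Theory.

Local Open Scope classical_set_scope.
Local Open Scope ring_scope.

(* The number of states is m = n.+1, so that the state space 'I_n.+1 is
   inhabited; the states 1, ..., m are numbered 0, ..., n. *)

Definition ones (R : realType) (n : nat) : 'cV[R]_n.+1 := const_mx 1.

Definition stdvec (R : realType) (n : nat) (i : 'I_n.+1) : 'cV[R]_n.+1 :=
  delta_mx i 0.

Definition diag_part (R : realType) (n : nat) (X : 'M[R]_n.+1) : 'M[R]_n.+1 :=
  diag_mx (\row_j X j j).

Definition stochastic (R : realType) (n : nat) (P : 'M[R]_n.+1) : Prop :=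
  (forall i j, 0 <= P i j) /\ (forall i, \sum_j P i j = 1).

(* Every state is accessible from every state. *)
Definition irreducible (R : realType) (n : nat) (P : 'M[R]_n.+1) : Prop :=
  forall i j, exists k : nat, 0 < (P ^+ k) i j.

Definition stationary_eqs (R : realType) (n : nat) (P : 'M[R]_n.+1)
    (x : 'rV[R]_n.+1) : Prop :=
  x *m (1%:M - P) = 0 /\ x *m ones R n = 1%:M.

Definition is_stationary_vector (R : realType) (n : nat) (P : 'M[R]_n.+1)
    (x : 'rV[R]_n.+1) : Prop :=
  unique (stationary_eqs P) x.

Definition group_inverse_eqs (R : realType) (n : nat) (A X : 'M[R]_n.+1) :
    Prop :=
  [/\ A *m X *m A = A, X *m A *m X = X & A *m X = X *m A].

Definition is_group_inverse (R : realType) (n : nat) (A X : 'M[R]_n.+1) :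
    Prop :=
  unique (group_inverse_eqs A) X.

(* Used only when B has positive probability. *)
Definition cond_prob (R : realType) (d : measure_display)
    (T : measurableType d) (Pr : probability T R) (A B : set T) : \bar R :=
  (Pr (A `&` B) / Pr B)%E.

Definition cond_expectation (R : realType) (d : measure_display)
    (T : measurableType d) (Pr : probability T R) (Y : T -> \bar R)
    (B : set T) : \bar R :=
  ((\int[Pr]_(w in B) Y w) / Pr B)%E.

(* The initial distribution is arbitrary.  As the state space is finite,
   measurability of X t is measurability of its level sets. *)
Definition markov_chain (R : realType) (n : nat) (P : 'M[R]_n.+1)
    (d : measure_display) (T : measurableType d) (Pr : probability T R)
    (X : nat -> T -> 'I_n.+1) : Prop :=
  (forall (t : nat) (i : 'I_n.+1), measurable [set w | X t w = i]) /\
  (forall (t : nat) (s : nat -> 'I_n.+1) (j : 'I_n.+1),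
     let history := [set w | forall k, (k <= t)%N -> X k w = s k] in
     (0 < Pr history)%E ->
     cond_prob Pr [set w | X t.+1 w = j] history = (P (s t) j)%:E).

(* min {k >= 1 : X_k = j}, with value +oo when j is never visited. *)
Definition first_passage_time (R : realType) (n : nat) (T : Type)
    (X : nat -> T -> 'I_n.+1) (j : 'I_n.+1) (w : T) : \bar R :=
  ereal_inf [set (k%:R)%:E | k in [set k : nat | (1 <= k)%N /\ X k w = j]].

Definition is_mean_first_passage (R : realType) (n : nat)
    (P M : 'M[R]_n.+1) : Prop :=
  forall (d : measure_display) (T : measurableType d) (Pr : probability T R)
    (X : nat -> T -> 'I_n.+1),
  markov_chain P Pr X ->
  forall i j : 'I_n.+1,
    (0 < Pr [set w | X 0%N w = i])%E ->
    cond_expectation Pr (first_passage_time R X j) [set w | X 0%N w = i]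
      = (M i j)%:E.

(* For i < n.+1, [inord i : 'I_n.+1] has value i; it stands for the state
   i + 1 of the 1-based numbering, which is the one treated at step i + 1. *)
Definition pert_row (R : realType) (n : nat) (P : 'M[R]_n.+1) (i : 'I_n.+1) :
    'rV[R]_n.+1 :=
  (stdvec R i)^T *m P - n.+1%:R^-1 *: (ones R n)^T.

Fixpoint pert_mx (R : realType) (n : nat) (P : 'M[R]_n.+1) (i : nat) :
    'M[R]_n.+1 :=
  if i is i'.+1 then
    pert_mx P i' + stdvec R (inord i') *m pert_row P (inord i')
  else n.+1%:R^-1 *: (ones R n *m (ones R n)^T).

Variant version := Alg4A | Alg4B | Alg4C.

Definition start_mx (R : realType) (n : nat) (v : version) : 'M[R]_n.+1 :=
  match v with
  | Alg4A => 1%:M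
  | Alg4B => 1%:M + ones R n *m
               (n.+1%:R^-1 *: (ones R n)^T - (stdvec R ord0)^T)
  | Alg4C => 1%:M - ((n.+1%:R - 1) / n.+1%:R ^+ 2) *:
               (ones R n *m (ones R n)^T)
  end.

(* The scalar k_{i+1} = 1 - b_{i+1}^T K_i e_{i+1}, for K = K_i. *)
Definition pivot (R : realType) (n : nat) (P K : 'M[R]_n.+1) (i : 'I_n.+1) :
    R :=
  1 - (pert_row P i *m K *m stdvec R i) 0 0.

Definition update_mx (R : realType) (n : nat) (P K : 'M[R]_n.+1)
    (i : 'I_n.+1) : 'M[R]_n.+1 :=
  (pivot P K i)^-1 *: (stdvec R i *m pert_row P i *m K).

Fixpoint iter_mx (R : realType) (n : nat) (P : 'M[R]_n.+1) (v : version)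
    (i : nat) : 'M[R]_n.+1 :=
  if i is i'.+1 then
    iter_mx P v i' *m (1%:M + update_mx P (iter_mx P v i') (inord i'))
  else start_mx R n v.

Definition output_row (R : realType) (n : nat) (v : version)
    (K : 'M[R]_n.+1) : 'rV[R]_n.+1 :=
  match v with
  | Alg4A => n.+1%:R^-1 *: ((ones R n)^T *m K)
  | Alg4B => (stdvec R ord0)^T *m K
  | Alg4C => (ones R n)^T *m K
  end.

(* Main.v *)
Require Import Defs.
From mathcomp Require Import all_boot all_order all_algebra.
From mathcomp Require Import all_classical all_reals all_analysis.
From mathcomp Require Import measurable_realfun.
From mathcomp Require Import ring.

(** Fix the row [u] with [u = e^T/m], [e_1^T] or [e^T] in the versions (4A),
    (4B), (4C).  The matrices [B_i = I - P_i + e u^T] are all invertible, since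
    [P_i] is irreducible and [u e <> 0], and each [B_i] differs from [B_(i-1)]
    by the rank-one term [- e_i b_i^T]; the recursion for [K_i] is the
    Sherman-Morrison formula, so [K_i] is the inverse of [B_i].  Multiplying
    [pi^T (I - P) = 0] by [K] gives [pi^T = u K], and with [A K = I - e pi^T]
    the matrix [(I - e pi^T) K] is checked to be the group inverse.  The same
    identity shows that [M] solves [M = E + P (M - M_d)].  In column [j] this
    reads [x = e + Q x], where [Q] is [P] with its [j]-th column erased.  Since
    [P(T_j > k | X_0 = i) = (Q^k e)_i], the mean first passage time is the
    Neumann series [sum_k Q^k e], which converges to any such [x]. *)

Set Implicit Arguments.
Unset Strict Implicit.
Unset Printing Implicit Defensive.

Import Order.TTheory GRing.Theory Num.Theory.
Import numFieldNormedType.Exports.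
Local Open Scope ring_scope.

(** * Stationary vectors and bordered matrices *)

Lemma mul_onesE (R : realType) (n : nat) (p : nat) (A : 'M[R]_(p, n.+1)) i k :
  (A *m ones R n) i k = \sum_j A i j.
Proof. by rewrite mxE; apply: eq_bigr => j _; rewrite mxE mulr1. Qed.

Lemma stochastic_ones (R : realType) (n : nat) (P : 'M[R]_n.+1) :
  stochastic P -> P *m ones R n = ones R n.
Proof. by case=> _ P1; apply/matrixP => i k; rewrite mul_onesE P1 mxE. Qed.

Lemma stochasticX (R : realType) (n : nat) (P : 'M[R]_n.+1) (k : nat) :
  stochastic P -> stochastic (P ^+ k).
Proof.
move=> Ps; elim: k => [|k [IH0 IH1]].
  rewrite expr0; split=> [i j|i]; first by rewrite mxE ler0n.
  by rewrite (bigD1 i)//= big1 ?mxE ?eqxx ?addr0// => j /negbTE ji; rewrite mxE eq_sym ji.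
rewrite exprS; split=> [i j|i].
  by rewrite mxE sumr_ge0// => l _; rewrite mulr_ge0// Ps.1.
rewrite -(mul_onesE _ _ 0) -mulmxE -mulmxA.
have -> : P ^+ k *m ones R n = ones R n by apply/matrixP => a b; rewrite mul_onesE IH1 mxE.
by rewrite stochastic_ones// mxE.
Qed.

(* Maximum principle: at a maximum of [y], the average [P^k y] is the maximum,
   so [y] is maximal at every state reachable from there. *)
Lemma irreducible_harmonic (R : realType) (n : nat) (P : 'M[R]_n.+1)
    (y : 'cV[R]_n.+1) :
  stochastic P -> irreducible P -> P *m y = y -> exists c, y = c *: ones R n.
Proof.
move=> Ps Pirr Py.
have Pky k : P ^+ k *m y = y.
  elim: k => [|k IH]; first by rewrite expr0 mul1mx.
  by rewrite exprS -mulmxE -mulmxA IH.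
pose i0 : 'I_n.+1 := [arg max_(i > ord0) y i 0]%O.
have ymax j : y j 0 <= y i0 0.
  by rewrite /i0; case: arg_maxP => // i _; apply.
exists (y i0 0); apply/matrixP => j z; rewrite ord1 !mxE mulr1.
have [k Pk0] := Pirr i0 j.
have [Q0 Q1] := stochasticX k Ps.
have H : \sum_l (P ^+ k) i0 l * (y i0 0 - y l 0) = 0.
  under eq_bigr do rewrite mulrBr.
  rewrite sumrB -mulr_suml Q1 mul1r.
  by apply/eqP; rewrite subr_eq0 -{1}(Pky k) mxE.
have /eqP := H; rewrite psumr_eq0; last first.
  by move=> l _; rewrite mulr_ge0// subr_ge0.
move=> /allP /(_ j); rewrite mem_index_enum => /(_ isT) /=.
by rewrite mulf_eq0 (gt_eqF Pk0) /= subr_eq0 => /eqP.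
Qed.

(* If [x] is a left null vector of [I - P] then so is [|x|], since
   [|x| <= |x| P] entrywise and both sides have the same sum. *)
Lemma stationary_exists (R : realType) (n : nat) (P : 'M[R]_n.+1) :
  stochastic P ->
  exists x : 'rV[R]_n.+1, stationary_eqs P x /\ forall j, 0 <= x 0 j.
Proof.
move=> Ps.
have : \det (1%:M - P) == 0.
  (* [det0P] speaks of left null vectors, so the right null vector e of I - P enters through the
     transpose. *)
  rewrite -det_tr; apply/det0P; exists (ones R n)^T.
    apply/eqP => /matrixP /(_ 0 0); rewrite !mxE => /eqP; by rewrite oner_eq0.
  by rewrite -trmx_mul mulmxBl mul1mx stochastic_ones// subrr trmx0.
case/det0P => x xn0; rewrite mulmxBr mulmx1 => /eqP; rewrite subr_eq0 => /eqP xP.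
pose y : 'rV[R]_n.+1 := \row_j `|x 0 j|.
have yP j : y 0 j <= (y *m P) 0 j.
  rewrite !mxE {1}xP mxE (le_trans (ler_norm_sum _ _ _))// ler_sum// => i _.
  by rewrite normrM mxE (ger0_norm (Ps.1 _ _)).
have yeq : y *m P = y.
  have : \sum_j ((y *m P) 0 j - y 0 j) = 0.
    rewrite sumrB -!(mul_onesE _ _ 0) -mulmxA stochastic_ones// subrr//.
  move/eqP; rewrite psumr_eq0; last by move=> j _; rewrite subr_ge0.
  move=> /allP H; apply/matrixP => i j; rewrite ord1.
  have := H j; rewrite mem_index_enum => /(_ isT) /=; by rewrite subr_eq0 => /eqP.
have y0 j : 0 <= y 0 j by rewrite mxE.
pose s := \sum_j y 0 j.
have s0 : 0 < s.
  have s_ge0 : 0 <= s by apply: sumr_ge0 => j _; exact: y0.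
  rewrite lt_neqAle s_ge0 andbT; apply/negP; rewrite eq_sym => /eqP s0; move/negP: xn0; apply; apply/eqP.
  apply/matrixP => i j; rewrite ord1 [RHS]mxE.
  have /eqP := s0; rewrite psumr_eq0; last by move=> l _; exact: y0.
  move=> /allP /(_ j); rewrite mem_index_enum => /(_ isT) /=.
  by rewrite mxE normr_eq0 => /eqP.
exists (s^-1 *: y); split; first split.
- by rewrite -scalemxAl mulmxBr mulmx1 yeq subrr scaler0.
- apply/matrixP => i j; rewrite !ord1 -scalemxAl mxE mul_onesE mulVf ?gt_eqF//.
  by rewrite mxE eqxx.
- by move=> j; rewrite mxE mulr_ge0// invr_ge0 ltW.
Qed.

(** Some x_i is positive because the entries sum to 1; then x = x P^k with (P^k)_ij > 0 passes
    positivity on to x_j. *)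
Lemma stationary_pos (R : realType) (n : nat) (P : 'M[R]_n.+1)
    (x : 'rV[R]_n.+1) :
  stochastic P -> irreducible P -> stationary_eqs P x ->
  (forall j, 0 <= x 0 j) -> forall j, 0 < x 0 j.
Proof.
move=> Ps Pirr [xP x1] x0 j.
have {}xP : x *m P = x.
  by move/eqP: xP; rewrite mulmxBr mulmx1 subr_eq0 => /eqP.
have xPk k : x *m P ^+ k = x.
  elim: k => [|k IH]; first by rewrite expr0 mulmx1.
  by rewrite exprSr -mulmxE mulmxA IH.
have [i xi] : exists i, 0 < x 0 i.
  apply: contrapT => /forallNP H.
  have := congr1 (fun A : 'M[R]_1 => A 0 0) x1; rewrite mul_onesE big1 ?mxE/=.
    by move/eqP; rewrite eq_sym oner_eq0.
  by move=> l _; apply/eqP; rewrite eq_le x0 andbT leNgt; apply/negP/H.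
have [k Pk] := Pirr i j.
rewrite -(xPk k) mxE (bigD1 i)//= ltr_wpDr ?mulr_gt0//.
by rewrite sumr_ge0// => l _; rewrite mulr_ge0// (stochasticX k Ps).1.
Qed.

(** For a column y killed by the matrix, multiplying on the left by a stationary x gives u y = 0,
    hence P y = y. The maximum principle makes y = d e, and u y = d c then forces d = 0. *)
Lemma bordered_unitmx (R : realType) (n : nat) (P : 'M[R]_n.+1)
    (u : 'rV[R]_n.+1) (c : R) :
  stochastic P -> irreducible P -> c != 0 -> u *m ones R n = c%:M ->
  1%:M - P + ones R n *m u \in unitmx.
Proof.
move=> Ps Pirr c0 uc; rewrite unitmxE unitfE.
have [x [[xP x1] _]] := stationary_exists Ps.
rewrite -det_tr; apply/negP => /det0P [z zn0 zB].
pose y := z^T.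
have By : (1%:M - P + ones R n *m u) *m y = 0.
  by rewrite -[LHS]trmxK trmx_mul /y trmxK zB trmx0.
have uy : u *m y = 0.
  have := congr1 (mulmx x) By.
  by rewrite mulmxA mulmxDr xP add0r mulmxA x1 mul1mx mulmx0.
have Py : P *m y = y.
  move: By; rewrite mulmxDl -mulmxA uy mulmx0 addr0 mulmxBl mul1mx => /eqP.
  by rewrite subr_eq0 => /eqP.
have [d yd] := irreducible_harmonic Ps Pirr Py.
move: uy; rewrite yd -scalemxAr uc => /matrixP /(_ 0 0).
rewrite !mxE eqxx mulr1n => /eqP; rewrite mulf_eq0 (negbTE c0) orbF => /eqP d0.
by move: zn0; rewrite -[z]trmxK -/y yd d0 scale0r trmx0 eqxx.
Qed.

(** The key identity is (B - a b) K a = k a. If k = 0, invertibility of B - a b gives K a = 0, so a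
    = B K a = 0. A nonzero pivot is thus a conclusion, drawn from the invertibility of the updated
    matrix. *)
Lemma sherman_morrison (R : realType) (n : nat) (B K : 'M[R]_n.+1)
    (a : 'cV[R]_n.+1) (b : 'rV[R]_n.+1) :
  B *m K = 1%:M -> B - a *m b \in unitmx -> a != 0 ->
  let k := 1 - (b *m K *m a) 0 0 in
  k != 0 /\
  (B - a *m b) *m (K *m (1%:M + k^-1 *: (a *m b *m K))) = 1%:M.
Proof.
move=> BK Bu a0 k.
have sE : b *m K *m a = (1 - k)%:M.
  by apply/matrixP => i j; rewrite !ord1 /k subKr [RHS]mxE eqxx mulr1n.
have BKa : (B - a *m b) *m (K *m a) = k *: a.
  rewrite mulmxBl mulmxA BK mul1mx -(mulmxA a b) (mulmxA b) sE mul_mx_scalar.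
  by rewrite scalerBl scale1r subKr.
have k0 : k != 0.
  apply: contraNneq a0 => k0; rewrite k0 scale0r in BKa.
  have Ka : K *m a = 0 by rewrite -(mulKmx Bu (K *m a)) BKa mulmx0.
  by rewrite -(mul1mx a) -BK -mulmxA Ka mulmx0.
(* (B - a b) K = I - a b K, and the correction term contributes exactly a b K. *)
split=> //; rewrite mulmxDr mulmx1 mulmxDr -scalemxAr -scalemxAr -(mulmxA a).
rewrite (mulmxA K) (mulmxA (B - _)) BKa -scalemxAl scalerA mulVf// scale1r.
by rewrite mulmxBl BK -(mulmxA a) subrK.
Qed.

(** * The algorithm *)

Lemma pert_rowE (R : realType) (n : nat) (P : 'M[R]_n.+1) i z j :
  pert_row P i z j = P i j - n.+1%:R^-1.
Proof.
rewrite ord1 !mxE (bigD1 i)//= big1 => [|l /negbTE li].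
  by rewrite !mxE !eqxx mul1r addr0 mulr1.
by rewrite !mxE li mul0r.
Qed.

(** Each step adds b^T to a row still equal to e^T/m, which turns it into the row of P. The bound on
    [i] keeps every [inord] at its intended value. *)
Lemma pert_mxE (R : realType) (n : nat) (P : 'M[R]_n.+1) (i : nat) :
  (i <= n.+1)%N -> forall a b,
  pert_mx P i a b = if (a < i)%N then P a b else n.+1%:R^-1.
Proof.
elim: i => [|i IH] ilt a b.
  by rewrite /= !mxE big_ord1 !mxE !mulr1.
rewrite /= mxE (IH (ltnW ilt)) mxE big_ord1 pert_rowE mxE eqxx andbT.
have := inordK ilt; set c := inord i : 'I_n.+1 => ci.
rewrite [(a < i.+1)%N]ltnS [(a <= i)%N]leq_eqVlt -[a == c]val_eqE /= ci.
have [ai|ai|ai] /= := ltngtP a i; [by rewrite mul0r addr0|by rewrite mul0r addr0|].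
have -> : c = a by apply: val_inj; rewrite /= ci.
by rewrite mul1r addrC subrK.
Qed.

Lemma pert_mx_full (R : realType) (n : nat) (P : 'M[R]_n.+1) :
  pert_mx P n.+1 = P.
Proof. by apply/matrixP => i j; rewrite pert_mxE// ltn_ord. Qed.

Lemma stochastic_pert_mx (R : realType) (n : nat) (P : 'M[R]_n.+1) (i : nat) :
  stochastic P -> (i <= n.+1)%N -> stochastic (pert_mx P i).
Proof.
move=> [P0 P1] ilt; split=> [a b|a].
  by rewrite pert_mxE//; case: (a < i)%N => //; rewrite invr_ge0 ler0n.
under eq_bigr do rewrite pert_mxE//.
case: (a < i)%N => //.
by rewrite sumr_const card_ord -[LHS]mulr_natr mulVf ?pnatr_eq0.
Qed.

(* Every version keeps [K_i = (I - P_i + e u^T)^-1] for a fixed row [u]. *)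
Definition border_row (R : realType) (n : nat) (v : version) : 'rV[R]_n.+1 :=
  match v with
  | Alg4A => n.+1%:R^-1 *: (ones R n)^T
  | Alg4B => (stdvec R ord0)^T
  | Alg4C => (ones R n)^T
  end.

Lemma output_rowE (R : realType) (n : nat) (v : version) (K : 'M[R]_n.+1) :
  output_row v K = border_row R n v *m K.
Proof. by case: v => //=; rewrite scalemxAl. Qed.

Lemma ones_tr_mul (R : realType) (n : nat) :
  (ones R n)^T *m ones R n = n.+1%:R%:M.
Proof.
apply/matrixP => i j; rewrite !ord1 mul_onesE.
under eq_bigr do rewrite !mxE.
by rewrite sumr_const card_ord mxE eqxx.
Qed.

Lemma stdvec_tr_ones (R : realType) (n : nat) (i : 'I_n.+1) :
  (stdvec R i)^T *m ones R n = 1%:M.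
Proof.
apply/matrixP => a b; rewrite !ord1 mul_onesE (bigD1 i)//= big1.
  by rewrite !mxE !eqxx addr0.
by move=> l /negbTE li; rewrite !mxE li.
Qed.

(** The value c = u e is 1, 1 and m in the three versions; the invertibility of I - P_i + e u rests
    on c being nonzero. *)
Lemma border_row_ones (R : realType) (n : nat) (v : version) :
  exists2 c : R, c != 0 & border_row R n v *m ones R n = c%:M.
Proof.
case: v => /=.
- exists 1; first exact: oner_neq0.
  by rewrite -scalemxAl ones_tr_mul scale_scalar_mx mulVf.
- exists 1; first exact: oner_neq0.
  exact: stdvec_tr_ones.
- by exists n.+1%:R; rewrite ?pnatr_eq0// ones_tr_mul.
Qed.

(** The bordered matrix is I in (4A). In (4B) it is I - e w with w = e^T/m - e_1^T and w e = 0, so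
    its inverse is I + e w. In (4C) it is I + (1 - 1/m) J with J = e e^T, inverted by means of J^2 =
    m J. *)
Lemma start_mxP (R : realType) (n : nat) (P : 'M[R]_n.+1) (v : version) :
  (1%:M - pert_mx P 0 + ones R n *m border_row R n v) *m start_mx R n v = 1%:M.
Proof.
have m0 : n.+1%:R != 0 :> R by rewrite pnatr_eq0.
case: v => /=.
- by rewrite -scalemxAr subrK mulmx1.
- set w := _ - _ : 'rV[R]_n.+1.
  have we : w *m ones R n = 0.
    rewrite mulmxBl -scalemxAl ones_tr_mul scale_scalar_mx mulVf//.
    by rewrite stdvec_tr_ones subrr.
  rewrite (_ : 1%:M - _ + _ = 1%:M - ones R n *m w); last first.
    by rewrite mulmxBr opprB -scalemxAr addrA addrAC.
  rewrite mulmxDr mulmx1 mulmxBl mul1mx -(mulmxA _ w) (mulmxA w) we mul0mx.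
  by rewrite mulmx0 subr0 subrK.
- set J := ones R n *m (ones R n)^T.
  have JJ : J *m J = n.+1%:R *: J.
    by rewrite /J -mulmxA (mulmxA _ (ones R n)) ones_tr_mul mul_scalar_mx -scalemxAr.
  rewrite (_ : 1%:M - _ + _ = 1%:M + (1 - n.+1%:R^-1) *: J); last first.
    by rewrite scalerBl scale1r addrA addrAC.
  rewrite mulmxBr mulmx1 mulmxDl mul1mx -scalemxAl -scalemxAr JJ !scalerA.
  rewrite -addrA -scalerDl -scalerBl.
  rewrite [X in X *: _](_ : _ = 0) ?scale0r ?addr0//; field.
  by rewrite addrC -[1]/(1%:R) -natrD addn1.
Qed.

(** Irreducibility of P_(j+1) makes the next bordered matrix invertible; Sherman-Morrison then
    yields both the nonzero pivot and the next inverse. *)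
Lemma iter_mxP (R : realType) (n : nat) (P : 'M[R]_n.+1) (v : version) :
  stochastic P -> (forall i : nat, (i <= n.+1)%N -> irreducible (pert_mx P i)) ->
  forall i, (i <= n.+1)%N ->
  (1%:M - pert_mx P i + ones R n *m border_row R n v) *m iter_mx P v i = 1%:M /\
  ((i < n.+1)%N -> pivot P (iter_mx P v i) (inord i) != 0).
Proof.
move=> Ps Pirr i; have [c c0 uc] := border_row_ones R n v.
have step j : (j < n.+1)%N ->
    (1%:M - pert_mx P j + ones R n *m border_row R n v) *m iter_mx P v j
      = 1%:M ->
    pivot P (iter_mx P v j) (inord j) != 0 /\
    (1%:M - pert_mx P j.+1 + ones R n *m border_row R n v)
      *m iter_mx P v j.+1 = 1%:M.
  move=> jn BK.
  have BE : 1%:M - pert_mx P j.+1 + ones R n *m border_row R n v =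
      1%:M - pert_mx P j + ones R n *m border_row R n v
      - stdvec R (inord j) *m pert_row P (inord j).
    by rewrite /= opprD addrA -[LHS]addrA (addrC (- (_ *m _))) addrA.
  have Bu := bordered_unitmx (stochastic_pert_mx Ps jn) (Pirr _ jn) c0 uc.
  rewrite BE in Bu.
  have a0 : stdvec R (inord j : 'I_n.+1) != 0.
    apply/eqP => /matrixP /(_ (inord j) 0); rewrite !mxE !eqxx => /eqP.
    by rewrite oner_eq0.
  by rewrite BE; exact: (sherman_morrison BK Bu a0).
have inv : forall j, (j <= n.+1)%N ->
    (1%:M - pert_mx P j + ones R n *m border_row R n v) *m iter_mx P v j = 1%:M.
  elim=> [_|j IH jn]; first exact: start_mxP.
  exact: (step j jn (IH (ltnW jn))).2.
move=> i_n; split=> [|ltin]; first exact: inv.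
exact: (step i ltin (inv _ i_n)).1.
Qed.

(** * Group inverse and passage system *)

Lemma mul_onesEl (R : realType) (n p : nat) (q : 'rV[R]_p) i j :
  (ones R n *m q) i j = q 0 j.
Proof. by rewrite mxE big_ord1 mxE mul1r. Qed.

Lemma diag_part_rank1 (R : realType) (n : nat) (q : 'rV[R]_n.+1) :
  diag_part (ones R n *m q) = diag_mx q.
Proof. by congr diag_mx; apply/rowP => j; rewrite mxE mul_onesEl. Qed.

Lemma diag_part_rank1_unitmx (R : realType) (n : nat) (q : 'rV[R]_n.+1) :
  (forall j, q 0 j != 0) -> diag_part (ones R n *m q) \in unitmx.
Proof.
by move=> q0; rewrite diag_part_rank1 unitmxE det_diag unitfE; apply/prodf_neq0.
Qed.

Lemma invmx_diag_part_rank1 (R : realType) (n : nat) (q : 'rV[R]_n.+1) :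
  (forall j, q 0 j != 0) ->
  invmx (diag_part (ones R n *m q)) = diag_mx (\row_j (q 0 j)^-1).
Proof.
move=> q0; have Du := diag_part_rank1_unitmx q0.
apply: (can_inj (mulKmx Du)); rewrite mulmxV// diag_part_rank1 mulmx_diag.
rewrite -diag_const_mx; congr diag_mx; apply/rowP => j.
by rewrite !mxE mulfV.
Qed.

(** By commutation A X = (A Y)(A X) = Y A X A = Y A = A Y, and then X = X A X = X A Y = A X Y = A Y
    Y = Y A Y = Y. *)
Lemma group_inverse_uniq (R : realType) (n : nat) (A X Y : 'M[R]_n.+1) :
  group_inverse_eqs A X -> group_inverse_eqs A Y -> X = Y.
Proof.
move=> [AXA XAX AX] [AYA YAY AY].
have E : A *m X = A *m Y.
  transitivity (A *m Y *m (A *m X)); first by rewrite mulmxA AYA.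
  by rewrite AX AY -!mulmxA (mulmxA A) AXA.
by rewrite -{1}XAX -mulmxA E mulmxA -AX E AY YAY.
Qed.

Section Bordered.
Context (R : realType) (n : nat) (P K : 'M[R]_n.+1) (u : 'rV[R]_n.+1) (c : R).
Hypotheses (Ps : stochastic P) (Pirr : irreducible P).
Hypotheses (c0 : c != 0) (uc : u *m ones R n = c%:M).
Hypothesis BK : (1%:M - P + ones R n *m u) *m K = 1%:M.

Let A := 1%:M - P.
Let e := ones R n.
Let pi := u *m K.

Lemma stationary_eqs_border x : stationary_eqs P x -> x = pi.
Proof.
move=> [xP x1]; have := congr1 (mulmx x) BK.
by rewrite mulmx1 mulmxA mulmxDr xP add0r (mulmxA x) x1 mul1mx => <-.
Qed.

Lemma border_stationary : is_stationary_vector P pi /\ forall j, 0 < pi 0 j.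
Proof.
have [x [xs x0]] := stationary_exists Ps.
rewrite -(stationary_eqs_border xs); split; last exact: stationary_pos xs x0.
by split=> // y /stationary_eqs_border ->; apply: stationary_eqs_border.
Qed.

Lemma generator_ones : A *m e = 0.
Proof. by rewrite mulmxBl mul1mx stochastic_ones// subrr. Qed.

Lemma generator_border : A *m K = 1%:M - e *m pi.
Proof. by move: BK; rewrite mulmxDl -(mulmxA e) => <-; rewrite addrK. Qed.

(** Put W = I - e pi and X = W K. Applying K B = I to e gives K e = e/c, so K A = I - e u/c. Since W
    e = 0 and A e = 0, both A X and X A equal W, and the equations reduce to W A = A and W W = W. *)
Lemma border_group_inverse : is_group_inverse A ((1%:M - e *m pi) *m K).
Proof.
have [[[piA pi1] _] _] := border_stationary.
have KB : K *m (A + e *m u) = 1%:M by exact: mulmx1C.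
have Ke : K *m e = c^-1 *: e.
  have : K *m (A + e *m u) *m e = e by rewrite KB mul1mx.
  rewrite -mulmxA mulmxDl generator_ones add0r -mulmxA uc mul_mx_scalar.
  by rewrite -scalemxAr => {2}<-; rewrite scalerA mulVf// scale1r.
have We : (1%:M - e *m pi) *m e = 0.
  by rewrite mulmxBl mul1mx -mulmxA pi1 mulmx1 subrr.
have KA : K *m A = 1%:M - c^-1 *: (e *m u).
  by rewrite -KB mulmxDr (mulmxA K) Ke -scalemxAl addrK.
have AX : A *m ((1%:M - e *m pi) *m K) = 1%:M - e *m pi.
  by rewrite mulmxA mulmxBr mulmx1 mulmxA generator_ones mul0mx subr0 generator_border.
have XA : (1%:M - e *m pi) *m K *m A = 1%:M - e *m pi.
  rewrite -mulmxA KA mulmxBr mulmx1 -scalemxAr (mulmxA _ e u) We mul0mx scaler0.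
  by rewrite subr0.
have X : group_inverse_eqs A ((1%:M - e *m pi) *m K).
  split; last by rewrite AX XA.
    by rewrite AX mulmxBl mul1mx -mulmxA piA mulmx0 subr0.
  rewrite XA mulmxA; congr (_ *m K).
  by rewrite mulmxBr mulmx1 (mulmxA _ e pi) We mul0mx subr0.
by split=> // Y; exact: group_inverse_uniq.
Qed.

Lemma diag_part_unitmx : diag_part (e *m pi) \in unitmx.
Proof.
have [_ pi0] := border_stationary.
by apply: diag_part_rank1_unitmx => j; rewrite gt_eqF.
Qed.

(** The diagonal of I - K + E K_d is all ones, so M_d is the inverse of Pi_d. Since A E = 0 and A -
    A K = e pi - P, it follows that A M = E - P M_d, which rearranges to the system. *)
Lemma border_passage_system :
  let M := (1%:M - K + const_mx 1 *m diag_part K)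
             *m invmx (diag_part (e *m pi)) in
  M = const_mx 1 + P *m (M - diag_part M).
Proof.
have Du := diag_part_unitmx.
(* Here [D] is Pi_d itself; its inverse [Di] is the D of the procedure. *)
set D := diag_part (e *m pi) in Du *.
set Di := invmx D => M.
have q0 j : pi 0 j != 0 by rewrite gt_eqF// (proj2 border_stationary j).
have Ddiag : Di = diag_mx (\row_j (pi 0 j)^-1) by exact: invmx_diag_part_rank1.
have Md : diag_part M = Di.
  rewrite {1}Ddiag /diag_part; congr diag_mx; apply/rowP => j.
  rewrite [LHS]mxE [RHS]mxE /M Ddiag mul_mx_diag [LHS]mxE [X in _ * X]mxE.
  suff -> : (1%:M - K + const_mx 1 *m diag_part K) j j = 1 by rewrite mul1r.
  rewrite mul_mx_diag !mxE eqxx mul1r; exact: subrK.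
have EJ : const_mx 1 = e *m e^T.
  by apply/matrixP => i j; rewrite !mxE big_ord1 !mxE mulr1.
have epiD : e *m pi *m Di = const_mx 1.
  by apply/matrixP => i j; rewrite Ddiag mul_mx_diag [LHS]mxE mul_onesEl [X in _ * X]mxE [RHS]mxE mulfV.
have AM : A *m M = const_mx 1 - P *m Di.
  rewrite /M mulmxA mulmxDr mulmxBr mulmx1 generator_border EJ -(mulmxA e).
  rewrite (mulmxA A e) generator_ones mul0mx addr0 -EJ -epiD -mulmxBl.
  by congr (_ *m _); rewrite /A opprB addrC addrA subrK.
move: AM; rewrite Md mulmxBl mul1mx => /eqP; rewrite subr_eq => /eqP {1}->.
by rewrite mulmxBr addrAC -addrA addrC -!addrA.
Qed.

End Bordered.

(** * Mean first passage times *)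

Section Neumann.
Context (R : realType) (n : nat) (Q : 'M[R]_n.+1) (m : 'cV[R]_n.+1).
Hypotheses (Q0 : forall i j, 0 <= Q i j) (Q1 : forall i, \sum_j Q i j <= 1).
Hypothesis mQ : m = ones R n + Q *m m.

Lemma substochasticX k : (forall i j, 0 <= (Q ^+ k) i j) /\
  forall i, \sum_j (Q ^+ k) i j <= 1.
Proof.
elim: k => [|k [IH0 IH1]].
  rewrite expr0; split=> [i j|i]; first by rewrite mxE ler0n.
  rewrite (bigD1 i)//= big1 ?mxE ?eqxx ?addr0// => j /negbTE ji.
  by rewrite mxE eq_sym ji.
rewrite exprS; split=> [i j|i].
  by rewrite mxE sumr_ge0// => l _; rewrite mulr_ge0.
rewrite -(mul_onesE _ _ 0) -mulmxE -mulmxA mxE (le_trans _ (Q1 i))//.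
by apply: ler_sum => l _; rewrite mul_onesE ler_piMr.
Qed.

Lemma neumann_partial k :
  m = \sum_(l < k) Q ^+ l *m ones R n + Q ^+ k *m m.
Proof.
elim: k => [|k IH]; first by rewrite big_ord0 add0r expr0 mul1mx.
rewrite big_ord_recr /= exprSr -mulmxE -addrA -mulmxA -mulmxDr -mQ; exact: IH.
Qed.

(* The partial sums [m - Q^k m] are bounded and nondecreasing, so their
   terms [Q^k e] tend to 0; these dominate the remainder [Q^k m]. *)
Lemma neumann_cvg i :
  (series (fun k => (Q ^+ k *m ones R n) i 0) @ \oo --> m i 0)%classic.
Proof.
pose f k := (Q ^+ k *m ones R n) i 0.
have f0 k : 0 <= f k.
  by rewrite /f mul_onesE sumr_ge0// => j _; apply: (substochasticX k).1.
(* One constant bounding all entries of m, so that |(Q^k m)_i| <= c (Q^k e)_i. *)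
pose c := \sum_j `|m j 0|.
have mc j : `|m j 0| <= c.
  by rewrite /c (bigD1 j)//= lerDl sumr_ge0.
have c0 : 0 <= c by rewrite sumr_ge0.
have rem k : `|(Q ^+ k *m m) i 0| <= c * f k.
  rewrite mxE (le_trans (ler_norm_sum _ _ _))// /f mul_onesE mulr_sumr.
  apply: ler_sum => j _; rewrite normrM (ger0_norm ((substochasticX k).1 i j)).
  by rewrite mulrC ler_wpM2r// (substochasticX k).1.
have SE k : series f k = m i 0 - (Q ^+ k *m m) i 0.
  rewrite {1}(neumann_partial k) mxE addrK summxE /series/= big_mkord.
  by [].
have f1 k : f k <= 1 by rewrite /f mul_onesE (substochasticX k).2.
have f_cvg : (f @ \oo --> (0 : R))%classic.
  apply: cvg_series_cvg_0; apply: nondecreasing_is_cvgn.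
    by apply: nondecreasing_series => k _ _; exact: f0.
  exists (`|m i 0| + c) => _ [k _ <-]; rewrite SE lerD ?ler_norm//.
  rewrite (le_trans (ler_norm _))// normrN (le_trans (rem k))//.
  by rewrite ler_piMr.
have rem0 : ((fun k => (Q ^+ k *m m) i 0) @ \oo --> (0 : R))%classic.
  have cf : ((fun k => c * f k) @ \oo --> (0 : R))%classic.
    by rewrite -(mulr0 c); apply: cvgMr.
  apply: (@squeeze_cvgr _ _ _ _ (fun k => - (c * f k)) (fun k => c * f k)) => //.
    by apply: nearW => k; rewrite -ler_norml rem.
  by rewrite -oppr0; apply: cvgN.
rewrite (_ : series _ = fun k => m i 0 - (Q ^+ k *m m) i 0); last exact/funext.
by rewrite -[X in (_ --> X)%classic]subr0; apply: cvgB => //; exact: cvg_cst.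
Qed.

End Neumann.

Lemma measure_fin_partition (R : realType) (d : measure_display)
    (T : measurableType d) (mu : {measure set T -> \bar R}) (F : finType)
    (Y : T -> F) (B : set T) :
  (forall y, measurable [set w | Y w = y])%classic -> measurable B ->
  mu B = (\sum_(y : F) mu (B `&` [set w | Y w = y])%classic)%E.
Proof.
move=> mY mB.
rewrite fsbig_seq ?index_enum_uniq//.
rewrite -measure_fin_bigcup; first last.
- by move=> y _; exact: measurableI.
- move=> y z _ _ [w [[_ <-] [_ <-]]] //.
- exact: finite_finset.
congr (mu _); apply/seteqP; split=> [w Bw|w [y _ []]//].
by exists (Y w) => //=; exact: mem_index_enum.
Qed.

(** * Path probabilities and tails of the first passage time *)

Section MarkovChain.
Context (R : realType) (n : nat) (P : 'M[R]_n.+1) (d : measure_display)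
  (T : measurableType d) (Pr : probability T R) (X : nat -> T -> 'I_n.+1).
Hypotheses (Ps : stochastic P) (mc : markov_chain P Pr X).
Local Open Scope classical_set_scope.

(** The past is packaged as a point of a finite type, so that events split into finitely many
    histories. *)
Definition trajectory t (w : T) : {ffun 'I_t.+1 -> 'I_n.+1} :=
  [ffun k : 'I_t.+1 => X k w].

Lemma trajectory_historyE t (s : {ffun 'I_t.+1 -> 'I_n.+1}) :
  [set w | trajectory t w = s] =
  [set w | forall k, (k <= t)%N -> X k w = s (inord k)].
Proof.
apply/seteqP; split=> w /= H.
  by move=> k kt; rewrite -H ffunE inordK.
by apply/ffunP => k; rewrite ffunE H ?inord_val// -ltnS ltn_ord.
Qed.

Lemma measurable_state t i : measurable [set w | X t w = i].
Proof. exact: mc.1. Qed.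

Lemma measurable_trajectory t s : measurable [set w | trajectory t w = s].
Proof.
rewrite trajectory_historyE.
rewrite (_ : [set w | _] =
  \bigcap_(k in [set k | (k <= t)%N]) [set w | X k w = s (inord k)]).
  by apply: bigcap_measurableType => k _; exact: measurable_state.
by apply/seteqP; split=> w /= H k; exact: H.
Qed.

Lemma markov_trajectory t s l :
  Pr ([set w | trajectory t w = s] `&` [set w | X t.+1 w = l])
  = (Pr [set w | trajectory t w = s] * (P (s ord_max) l)%:E)%E.
Proof.
have mH := measurable_trajectory s.
have := measure_ge0 Pr [set w | trajectory t w = s].
rewrite le_eqVlt => /predU1P[H0|H0].
  (* For a null history the Markov property says nothing; both sides are then 0 by monotonicity. *)
  rewrite -H0 mul0e; apply/eqP; rewrite eq_le measure_ge0 andbT H0.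
  by apply: le_measure; rewrite ?inE//; apply: measurableI => //;
    exact: measurable_state.
have := mc.2 t (fun k => s (inord k)) l; rewrite /= -trajectory_historyE.
move=> /(_ H0); rewrite /cond_prob setIC.
rewrite (_ : inord t = ord_max) => [<-|]; last first.
  by apply: val_inj; rewrite /= inordK.
by rewrite muleC -muleA mulVe ?mule1 ?gt_eqF// fin_num_measure.
Qed.

(** The second hypothesis says that A depends only on X_0, ..., X_t. Each history up to t therefore
    either implies A and X_t = a or excludes them, and the claim is a sum over single histories. *)
Lemma markov_past t a l (A : set T) : measurable A ->
  (forall w w', (forall k, (k <= t)%N -> X k w = X k w') -> A w -> A w') ->
  Pr (A `&` [set w | X t w = a] `&` [set w | X t.+1 w = l])
  = (Pr (A `&` [set w | X t w = a]) * (P a l)%:E)%E.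
Proof.
move=> mA Apast.
have mAa := measurableI _ _ mA (measurable_state t a).
have mAl := measurableI _ _ mAa (measurable_state t.+1 l).
rewrite (measure_fin_partition Pr (@measurable_trajectory t) mAl).
rewrite (measure_fin_partition Pr (@measurable_trajectory t) mAa).
rewrite ge0_sume_distrl//; apply: eq_bigr => s _.
have [[w [Aw /= wa ws]]|no] := pselect
    (exists w, [/\ A w, X t w = a & trajectory t w = s]).
  have sub : [set w | trajectory t w = s] `<=` A `&` [set w | X t w = a].
    move=> w'; rewrite /= -ws => /ffunP E.
    have E' k : (k <= t)%N -> X k w = X k w'.
      by move=> kt; have := E (inord k); rewrite !ffunE inordK.
    by split; [exact: Apast Aw|rewrite /= -E'].
  rewrite (setIAC (A `&` _)) (setIidr sub) markov_trajectory -ws ffunE /= wa//.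
have e : A `&` [set w | X t w = a] `&` [set w | trajectory t w = s] = set0.
  by apply/seteqP; split=> // w [[Aw wa] ws]; apply: no; exists w.
by rewrite (setIAC (A `&` _)) e set0I measure0 mul0e.
Qed.

Context (i j : 'I_n.+1).

(** Its k-th power holds the probabilities of moving between two states in k steps without being at
    j at times 1, ..., k; the start may be j. *)
Definition taboo_mx : 'M[R]_n.+1 := \matrix_(a, b) (if b == j then 0 else P a b).

Lemma taboo_mx_ge0 a b : 0 <= taboo_mx a b.
Proof. by rewrite mxE; case: ifP => // _; exact: Ps.1. Qed.

Lemma taboo_mx_le1 a : \sum_b taboo_mx a b <= 1.
Proof.
rewrite -(Ps.2 a) ler_sum// => b _; rewrite mxE; case: ifP => // _.
exact: Ps.1.
Qed.

Let taboo_mxX_ge0 k a b : 0 <= (taboo_mx ^+ k) a b.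
Proof. exact: (substochasticX taboo_mx_ge0 taboo_mx_le1 k).1. Qed.

(** Time 0 is left out, so this is the event that the first passage time to j exceeds k, even from j
    itself. *)
Definition avoid k := [set w | forall s, (1 <= s <= k)%N -> X s w <> j].

Lemma measurable_avoid k : measurable (avoid k).
Proof.
rewrite (_ : avoid k =
  \bigcap_(s in [set s | (1 <= s <= k)%N]) ~` [set w | X s w = j]).
  apply: bigcap_measurableType => s _; apply: measurableC.
  exact: measurable_state.
by apply/seteqP; split=> w /= H s; exact: H.
Qed.

Lemma measurable_start_avoid k :
  measurable ([set w | X 0 w = i] `&` avoid k).
Proof. by apply: measurableI; [exact: measurable_state|exact: measurable_avoid]. Qed.

(** Induction on k, splitting on the state at time k. A final state j gives 0 on both sides;
    otherwise the Markov property applies to the past event of starting at i and avoiding j up to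
    k. *)
Lemma taboo_prob k a :
  Pr ([set w | X 0 w = i] `&` avoid k `&` [set w | X k w = a])
  = (Pr [set w | X 0 w = i] * ((taboo_mx ^+ k) i a)%:E)%E.
Proof.
elim: k a => [|k IH] a.
  rewrite expr0 mxE (_ : avoid 0 = setT); last first.
    by apply/seteqP; split=> // w _ s; case: s.
  rewrite setIT; have [<-|ia] := eqVneq i a; first by rewrite setIid mule1.
  rewrite mule0 (_ : _ `&` _ = set0) ?measure0//.
  by apply/seteqP; split=> // w [/= -> /eqP]; rewrite (negbTE ia).
rewrite exprSr -mulmxE mxE -sumEFin.
have B0 b : (0 <= ((taboo_mx ^+ k) i b * taboo_mx b a)%:E)%E.
  by rewrite lee_fin mulr_ge0// taboo_mx_ge0.
rewrite ge0_sume_distrr//.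
have m1 := measurableI _ _ (measurable_start_avoid k.+1) (measurable_state k.+1 a).
rewrite (measure_fin_partition Pr (measurable_state k) m1).
apply: eq_bigr => b _.
rewrite EFinM muleA -IH [taboo_mx b a]mxE.
have [->|aj] := eqVneq a j.
  rewrite mule0 (_ : _ `&` _ = set0) ?measure0//.
  apply/seteqP; split=> // w [[[_ /= av] Xj] _].
  by apply: (av k.+1 _ Xj); rewrite ltnS leq0n leqnn.
rewrite -markov_past; first last.
- move=> w w' E [wi av]; split; first by rewrite /= -E.
  by move=> s /andP[s1 sk]; rewrite -E//; apply: av; rewrite s1 sk.
- exact: measurable_start_avoid.
(* As X_(k+1) = a differs from j, avoiding j up to k+1 amounts to avoiding it up to k. *)
congr (Pr _); apply/seteqP; split=> w /=.
  move=> [[[wi av] wa] wb]; split=> //; split=> //; split=> // s /andP[s1 sk].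
  by apply: av; rewrite s1 leqW.
move=> [[[wi av] wb] wa]; split=> //; split=> //; split=> // s.
rewrite (leq_eqVlt s) => /andP[s1 /predU1P[->|sk]].
  by rewrite wa; apply/eqP.
by apply: av; rewrite s1.
Qed.

Lemma avoid_prob k :
  Pr ([set w | X 0 w = i] `&` avoid k)
  = (Pr [set w | X 0 w = i] * ((taboo_mx ^+ k *m ones R n) i 0)%:E)%E.
Proof.
rewrite (measure_fin_partition Pr (measurable_state k) (measurable_start_avoid k)).
rewrite mul_onesE -sumEFin ge0_sume_distrr; last first.
  by move=> a _; rewrite lee_fin.
by apply: eq_bigr => a _; exact: taboo_prob.
Qed.

(** An integer time T >= 1 is the sum over k >= 0 of the indicators of T > k. This includes T = +oo,
    where every indicator is 1 and the series diverges. *)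
Lemma first_passage_timeE w :
  first_passage_time R X j w = (\sum_(0 <= k <oo) (\1_(avoid k) w)%:E)%E.
Proof.
have [[s [s1 sj]]|never] := pselect (exists s, (1 <= s)%N /\ X s w = j).
  have ex : exists s, (1 <= s)%N && (X s w == j).
    by exists s; rewrite s1 sj eqxx.
  (* N is the first visit, so the indicator at k is 1 exactly when k < N. *)
  case: (ex_minnP ex) => N /andP[N1 /eqP Nj] Nmin.
  have avE k : \1_(avoid k) w = ((k < N)%N)%:R :> R.
    rewrite indicE; congr (_%:R); congr nat_of_bool; apply/idP/idP.
      rewrite inE ltnNge => av; apply/negP => Nk.
      by apply: (av N) => //; rewrite N1 Nk.
    move=> kN; rewrite inE => r /andP[r1 rk] rj.
    by have := Nmin r; rewrite r1 rj eqxx leqNgt (leq_ltn_trans rk kN) => /(_ isT).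
  rewrite (nneseries_split 0 N) => [|k _]; last by rewrite avE lee_fin ler0n.
  rewrite add0n eseries0 => [|k Nk _]; last by rewrite avE ltnNge Nk.
  rewrite adde0 big_mkord (eq_bigr (fun=> 1%E)); last by move=> k _; rewrite avE ltn_ord.
  rewrite -[RHS]/(_) sumEFin sumr_const card_ord.
  apply/eqP; rewrite eq_le; apply/andP; split.
    by apply: ereal_inf_lbound; exists N.
  apply: le_ereal_inf_tmp => _ [k [k1 kj] <-].
  by rewrite lee_fin ler_nat; apply: Nmin; rewrite k1 kj eqxx.
rewrite /first_passage_time (_ : [set k | _] = set0); last first.
  by apply/seteqP; split=> // k kj; apply: never; exists k.
rewrite image_set0 ereal_inf0; apply/esym/cvg_lim => //.
rewrite (_ : (fun _ => _) = fun N => (N%:R)%:E).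
  by apply/cvgeryP; exact: cvgr_idn.
apply/funext => N; rewrite big_mkord (eq_bigr (fun=> 1%E)); last first.
  move=> k _; rewrite indicE mem_set// => s /andP[s1 _] sj.
  by apply: never; exists s.
by rewrite sumEFin sumr_const card_ord.
Qed.

(** Nonnegativity allows integration term by term, each term being Pr B times (Q^k e)_i. Finiteness
    of the mean is not presupposed: it comes out of the convergence of the Neumann series. *)
Lemma mean_first_passage (m : 'cV[R]_n.+1) :
  m = ones R n + taboo_mx *m m -> (0 < Pr [set w | X 0 w = i])%E ->
  cond_expectation Pr (first_passage_time R X j) [set w | X 0 w = i]
  = (m i 0)%:E.
Proof.
move=> mQ Pi0; set B := [set w | X 0 w = i].
have mB : measurable B := measurable_state 0 i.
rewrite /cond_expectation.
have -> : (\int[Pr]_(w in B) first_passage_time R X j w = Pr B * (m i 0)%:E)%E.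
  rewrite (eq_integral (fun w => \sum_(0 <= k <oo) (\1_(avoid k) w)%:E)%E);
    last by move=> w _; exact: first_passage_timeE.
  rewrite integral_nneseries//; last first.
    by move=> k; apply/measurable_EFinP; apply: measurable_indic;
      exact: measurable_avoid.
  have term k : (\int[Pr]_(w in B) (\1_(avoid k) w)%:E
      = Pr B * ((taboo_mx ^+ k *m ones R n) i 0)%:E)%E.
    rewrite integral_indic//; last exact: measurable_avoid.
    by rewrite setIC; exact: avoid_prob.
  rewrite (eq_eseriesr (fun k _ => term k)).
  have Bfin : Pr B \is a fin_num by exact: fin_num_measure.
  rewrite -(fineK Bfin) nneseriesZl; last first.
    by move=> k _; rewrite lee_fin mul_onesE sumr_ge0.
  congr (_ * _)%E; apply/cvg_lim => //.
  apply: cvg_EFin; first by apply: nearW => k; rewrite sumEFin.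
  rewrite (_ : _ \o _ = series (fun k => (taboo_mx ^+ k *m ones R n) i 0)).
    exact: (neumann_cvg taboo_mx_ge0 taboo_mx_le1).
  by apply/funext => k; rewrite /= sumEFin.
by rewrite muleAC divee ?mul1e ?gt_eqF// fin_num_measure.
Qed.

End MarkovChain.

(** In column j, subtracting M_d removes exactly the entry M_jj, which acts in the product like
    erasing column j of P. *)
Lemma passage_system_mean_first_passage (R : realType) (n : nat)
    (P M : 'M[R]_n.+1) :
  stochastic P -> M = const_mx 1 + P *m (M - diag_part M) ->
  is_mean_first_passage P M.
Proof.
move=> Ps ME d T Pr X mc i j Pi0.
rewrite (mean_first_passage Ps mc (m := col j M) _ Pi0) ?mxE//.
apply/colP => a; rewrite [LHS]mxE {1}ME [LHS]mxE [RHS]mxE.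
congr (_ + _); first by rewrite !mxE.
rewrite [LHS]mxE [RHS]mxE; apply: eq_bigr => b _.
rewrite !mxE eq_sym; case: eqVneq => [->|_]; last by rewrite mulr0n subr0.
by rewrite mulr1n subrr mulr0 mul0r.
Qed.

(** The nonzero pivots and the invertibility of Pi_d certify that the inverses taken in the
    procedure are genuine and not default values. *)
Theorem mainTheorem6 (R : realType) (n : nat) (P : 'M[R]_n.+1)
    (Pstoch : stochastic P) (Pirr : irreducible P)
    (Piirr : forall i : nat, (i <= n.+1)%N -> irreducible (pert_mx P i))
    (v : version) :
  let K := iter_mx P v n.+1 in
  let pi := output_row v K in
  let Pi := ones R n *m pi in
  let D := invmx (diag_part Pi) in
  let E := const_mx 1 : 'M[R]_n.+1 in
  (forall i : nat, (i < n.+1)%N -> pivot P (iter_mx P v i) (inord i) != 0) /\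
  is_stationary_vector P pi /\
  is_group_inverse (1%:M - P) ((1%:M - ones R n *m pi) *m K) /\
  diag_part Pi \in unitmx /\
  is_mean_first_passage P ((1%:M - K + E *m diag_part K) *m D).
Proof.
move=> K pi Pi D E.
have [c c0 uc] := border_row_ones R n v.
have BK : (1%:M - P + ones R n *m border_row R n v) *m K = 1%:M.
  by rewrite -{1}(pert_mx_full P); exact: (iter_mxP v Pstoch Piirr (leqnn _)).1.
have piE : pi = border_row R n v *m K by exact: output_rowE.
have [pi_stat _] := border_stationary Pstoch Pirr BK.
rewrite /D /Pi piE; split; last split=> //; last split; last split.
- by move=> i lt_in; exact: (iter_mxP v Pstoch Piirr (ltnW lt_in)).2.
- exact: border_group_inverse Pstoch Pirr c0 uc BK.
- exact: diag_part_unitmx Pstoch Pirr BK.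
- apply: passage_system_mean_first_passage => //.
  exact: border_passage_system Pstoch Pirr BK.
Qed.
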